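(* Let $n\ge 4$ be an even integer and let $G$ be a finite solvable group whose character degree graph $\Delta(G)$ has $n$ vertices and is $(n-2)$-regular. Then the characteristic polynomial of (the adjacency matrix of) $\Delta(G)$ is \[ \chi(x)=x^{\frac{n}{2}}\,(x+2)^{\frac{n}{2}-1}\,\bigl(x-(n-2)\bigr). \] Moreover, the splitting field of $\chi(x)$ over $\mathbb{Q}$ is $\mathbb{Q}$, and hence the extension degree is $1$.
   Context: For a finite group $G$, let $\mathrm{Irr}(G)$ be the set of irreducible complex characters of $G$, $\mathrm{cd}(G)=\{\chi(1)\mid\chi\in\mathrm{Irr}(G)\}$, and let $\rho(G)$ be the set of all primes dividing some element of $\mathrm{cd}(G)$. The character degree graph $\Delta(G)$ is the simple undirected graph with vertex set $\rho(G)$ in which two distinct primes $p,q$ are adjacent if and only if $pq$ divides $\chi(1)$ for some $\chi\in\mathrm{Irr}(G)$. The characteristic polynomial of a graph with adjacency matrix $A$ is $\det(xI-A)$. *)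

(* Defs.v *)
From mathcomp Require Import all_boot all_order all_algebra all_fingroup.
From mathcomp Require Import all_solvable all_field all_character.

Set Implicit Arguments.
Unset Strict Implicit.
Unset Printing Implicit Defensive.

Import GRing.Theory.

(* Class functions take values in algC, where character values lie anyway.
   Each 'chi_i 1 is a natural number in algC, so truncn merely reads it off. *)
Definition char_degrees (gT : finGroupType) (G : {group gT}) : seq nat :=
  undup [seq Num.truncn ('chi[G]_i 1%g) | i : Iirr G].

Definition degree_primes (gT : finGroupType) (G : {group gT}) : seq nat :=
  undup (flatten [seq primes d | d <- char_degrees G]).

Definition cdg_vertex (gT : finGroupType) (G : {group gT}) : finType :=
  seq_sub (degree_primes G).

Definition cdg_adj (gT : finGroupType) (G : {group gT}) :
    rel (cdg_vertex G) :=
  fun p q => (val p != val q)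
    && has (fun d => val p * val q %| d)%N (char_degrees G).

Definition regular_graph (T : finType) (e : rel T) (k : nat) : Prop :=
  forall v : T, #|[set w | e v w]| = k.

(* Rows and columns follow the enumeration of T; the characteristic
   polynomial does not depend on this choice. *)
Definition adjacency_mx (T : finType) (e : rel T) : 'M[rat]_#|T| :=
  (\matrix_(i, j) (e (enum_val i) (enum_val j))%:R)%R.

Definition graph_char_poly (T : finType) (e : rel T) : {poly rat} :=
  char_poly (adjacency_mx e).

(* Main.v *)
(** An [(n-2)]-regular graph on [n] vertices is the complement of a perfect
    matching.  If [P] is the permutation
    matrix of the matching, then [xI - A = M - J] with [M = (x+1)I + P] and [J]
    the all-ones matrix.  As [MJ = (x+2)J], we have
    [(x+2)(M - J) = M((x+2)I - J)], where [det ((x+2)I - J)] is that of a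
    rank-one perturbation.  A diagonal sign matrix separating the two ends of
    each matching edge conjugates [P] to [-P], so that
    [det M ^ 2 = det ((x+1)I + P) * det ((x+1)I - P) = (x(x+2))^n]. *)
Require Import Defs.
From mathcomp Require Import all_boot all_order all_algebra all_fingroup.
From mathcomp Require Import all_solvable all_field all_character.
From mathcomp Require Import ring.

Set Implicit Arguments.
Unset Strict Implicit.
Unset Printing Implicit Defensive.

Import GRing.Theory.
Local Open Scope ring_scope.

(** Both sides come from the block matrix with rows [(y, u)] and [(v, 1)]: a unitriangular factor on
    the right clears [v], and a triangular factor of determinant [y] on the left does so too. The
    extra [y] avoids dividing in [R]. *)
Lemma det_scalar_sub_rank1 (R : comNzRingType) (n : nat) (y : R)
    (u : 'cV[R]_n) (v : 'rV[R]_n) :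
  y * \det (y%:M - u *m v) = y ^+ n * (y - (v *m u) 0 0).
Proof.
pose B := block_mx y%:M u v 1%:M.
have detB : \det B = \det (y%:M - u *m v).
  have : \det (B *m block_mx 1%:M 0 (- v) 1%:M) = \det B.
    by rewrite det_mulmx det_lblock !det1 !mulr1.
  rewrite mulmx_block !mulmx1 !mulmx0 !mul1mx mulmxN !add0r subrr.
  by rewrite det_ublock det1 mulr1 => ->.
have : \det (block_mx 1%:M 0 (- v) y%:M *m B) = y * \det B.
  by rewrite det_mulmx det_lblock det1 mul1r det_scalar1.
rewrite mulmx_block !mul1mx !mul0mx !addr0 mulmx1 mul_mx_scalar mul_scalar_mx.
rewrite scalerN addNr det_ublock det_scalar det_mx11 detB => <-.
by rewrite mulNmx 2!mxE [y%:M 0 0]mxE eqxx mulr1n addrC.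
Qed.

Section MatchingMatrix.

Variables (R : comNzRingType) (n : nat) (s : 'I_n -> 'I_n).
Hypothesis sK : involutive s.
Hypothesis s_neq : forall i, s i != i.

Definition matching_mx : 'M[R]_n := \matrix_(i, j) (j == s i)%:R.

Lemma matching_mxE m (B : 'M[R]_(n, m)) i j :
  (matching_mx *m B) i j = B (s i) j.
Proof.
rewrite mxE (bigD1 (s i)) //= mxE eqxx mul1r big1 ?addr0 // => k /negPf ne.
by rewrite mxE ne mul0r.
Qed.

Lemma matching_mx_sqr : matching_mx *m matching_mx = 1%:M.
Proof. by apply/matrixP=> i j; rewrite matching_mxE !mxE sK eq_sym. Qed.

Lemma det_matching_opp (y : R) :
  \det (y%:M - matching_mx) = \det (y%:M + matching_mx).
Proof.
(* The sign is -1 exactly at the smaller end of each pair [{i, s i}]. *)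
pose d : 'rV[R]_n := \row_i (-1) ^+ (i < s i)%N.
have dd : diag_mx d *m diag_mx d = 1%:M.
  by rewrite mulmx_diag; apply/matrixP=> i j; rewrite !mxE -signr_addb addbb.
have dPd : diag_mx d *m matching_mx *m diag_mx d = - matching_mx.
  apply/matrixP=> i j; rewrite mul_mx_diag mul_diag_mx !mxE.
  case: eqP => [->|]; last by rewrite mulr0 mul0r oppr0.
  rewrite sK mulr1 -signr_addb.
  by case: ltngtP (s_neq i) => // /val_inj<-; rewrite eqxx.
have -> : y%:M - matching_mx
    = diag_mx d *m (y%:M + matching_mx) *m diag_mx d.
  by rewrite mulmxDr mulmxDl dPd mul_mx_scalar -scalemxAl dd scalemx1.
by rewrite !det_mulmx mulrAC -det_mulmx dd det1 mul1r.
Qed.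

Lemma det_matching_sqr (y : R) :
  \det (y%:M + matching_mx) ^+ 2 = (y ^+ 2 - 1) ^+ n.
Proof.
rewrite expr2 -{2}det_matching_opp -det_mulmx -det_scalar; congr (\det _).
rewrite mulmxDl !mulmxBr matching_mx_sqr -scalar_mxM.
rewrite mul_mx_scalar mul_scalar_mx addrA subrK.
by rewrite raddfB /= -expr2.
Qed.

End MatchingMatrix.

(** Seeing [M] as a characteristic matrix makes its determinant monic, which later fixes the sign of
    a square root. *)
Lemma char_poly_mx_matching (R : comNzRingType) (n : nat) (s : 'I_n -> 'I_n) :
  char_poly_mx (- (1%:M + matching_mx R s))
    = ('X + 1)%:M + matching_mx {poly R} s.
Proof.
apply/matrixP=> i j; rewrite !mxE polyCN opprK polyCD.
by rewrite !polyC_natr mulrnDl addrA.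
Qed.

Lemma char_poly_matching (F : numFieldType) (n : nat) (s : 'I_n -> 'I_n) :
    involutive s -> (forall i, s i != i) -> ~~ odd n ->
  char_poly (- (1%:M + matching_mx F s))
    = ('X * ('X + 2%:R%:P)) ^+ n./2.
Proof.
move=> sK s_neq even_n; set q := _ ^+ _.
have mon_q : q \is monic.
  apply: monic_exp; rewrite monicMl ?monicX //.
  by rewrite -[2%:R%:P]opprK -polyCN monicXsubC.
have : char_poly (- (1%:M + matching_mx F s)) ^+ 2 == q ^+ 2.
  rewrite /char_poly char_poly_mx_matching det_matching_sqr // -exprM muln2 halfK (negPf even_n).
  by rewrite subn0; apply/eqP; congr (_ ^+ _); rewrite polyC_natr; ring.
(* Both polynomials are monic, so the root [- q] would force 1 = -1. *)
rewrite eqf_sqr => /orP[/eqP // | /eqP eq_opp].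
have := congr1 lead_coef eq_opp.
rewrite lead_coefN (monicP mon_q) (monicP (char_poly_monic _)) => /eqP.
by rewrite -subr_eq0 opprK -[1 + 1]/(2%:R) Num.Theory.pnatr_eq0.
Qed.

Lemma char_poly_cocktail_party (F : numFieldType) (n : nat)
    (s : 'I_n -> 'I_n) :
    involutive s -> (forall i, s i != i) -> ~~ odd n -> (1 < n)%N ->
  char_poly (\matrix_(i, j) ((j != i) && (j != s i))%:R : 'M[F]_n)
    = 'X ^+ n./2 * ('X + 2%:R%:P) ^+ (n./2 - 1) * ('X - (n - 2)%:R%:P).
Proof.
move=> sK s_neq even_n n_gt1.
set A := (X in char_poly X); set y := 'X + _.
pose M := char_poly_mx (- (1%:M + matching_mx F s)).
pose u : 'cV[{poly F}]_n := const_mx 1; pose v : 'rV[{poly F}]_n := const_mx 1.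
have y_neq0 : y != 0.
  by rewrite /y -[2%:R%:P]opprK -polyCN polyXsubC_eq0.
have Mdef := char_poly_mx_matching F s : M = _.
have Adef : char_poly_mx A = M - u *m v.
  rewrite Mdef; apply/matrixP=> i j; rewrite !mxE big_ord1 !mxE mulr1 polyC_natr.
  rewrite (eq_sym i j); have := s_neq i.
  case: (eqVneq j i) => [->|_] /=.
    by rewrite eq_sym => /negPf->; rewrite mulr1n addr0; ring.
  by case: (j == s i) => _ /=; rewrite mulr0n; ring.
(* Each row of [M] sums to [('X + 1) + 1]. *)
have Mu : M *m u = y *: u.
  rewrite Mdef mulmxDl mul_scalar_mx; apply/matrixP=> i j.
  by rewrite [LHS]mxE matching_mxE !mxE /y polyC_natr; ring.
have vu : (v *m u) 0 0 = n%:R.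
  rewrite mxE (eq_bigr (fun=> 1)) => [|i _]; last by rewrite !mxE mulr1.
  by rewrite sumr_const card_ord.
have scaled : y ^+ n * char_poly A = \det M * \det (y%:M - u *m v).
  rewrite /char_poly Adef -detZ -det_mulmx; congr (\det _).
  by rewrite mulmxBr mul_mx_scalar mulmxA Mu -scalemxAl scalerBr.
have detM : \det M = ('X * y) ^+ n./2 by exact: char_poly_matching.
(* The power [y ^+ n] comes from scaling the matrix by [y], the further [y] from the rank-one
   formula, whose last factor is [y - n = 'X - (n - 2)]. *)
apply: (mulfI y_neq0); apply: (mulfI (expf_neq0 n y_neq0)).
rewrite mulrCA scaled mulrCA det_scalar_sub_rank1 detM vu exprMn.
have half_gt0 : (0 < n./2)%N by rewrite half_gt0.
rewrite -{2}(subnK half_gt0) addn1 exprS polyC_natr natrB //.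
by rewrite /y polyC_natr; ring.
Qed.

(** Besides itself, a vertex misses exactly one other, which is taken as its image under [s];
    symmetry of [e] makes [s] an involution. *)
Lemma regular_co_matching (T : finType) (e : rel T) :
    symmetric e -> irreflexive e -> (1 < #|T|)%N ->
    regular_graph e (#|T| - 2) ->
  exists s : T -> T, [/\ involutive s, forall x, s x != x
    & forall x y, e x y = (y != x) && (y != s x)].
Proof.
move=> e_sym e_irr T_gt1 reg.
have nonadj x : exists y, forall z, (z != x) && ~~ e x z = (z == y).
  have /eqP/cards1P[y def_y] : #|[set z | (z != x) && ~~ e x z]| = 1%N.
    have -> : [set z | (z != x) && ~~ e x z] = ~: (x |: [set z | e x z]).
      by apply/setP=> z; rewrite !inE negb_or.
    (* Removing [x] and its [#|T| - 2] neighbours leaves one vertex; [1 < #|T|] keeps the truncated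
       subtraction exact. *)
    by rewrite cardsCs setCK cardsU1 inE e_irr reg add1n subnSK // subKn // ltnW.
  by exists y => z; move/setP/(_ z): def_y; rewrite !inE.
have [s sP] := fin_all_exists nonadj.
have s_neq x : s x != x by have := sP x (s x); rewrite eqxx => /andP[].
exists s; split=> // [x | x y].
  have := sP x (s x); rewrite eqxx => /andP[_ ne].
  by have := sP (s x) x; rewrite eq_sym s_neq e_sym ne => /esym/eqP.
have := sP x y; case: eqP => [-> | _] /=; first by rewrite e_irr.
by move=> <-; rewrite negbK.
Qed.

(** The roots already lie in the image of [F], so adjoining them to the base field adds nothing. *)
Lemma splittingFieldFor_split (F : fieldType) (L : fieldExtType F)
    (E : {vspace L}) (rs : seq F) :
  splittingFieldFor 1 (map_poly (in_alg L) (\prod_(z <- rs) ('X - z%:P))) E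
    <-> E = 1%VS.
Proof.
have -> : map_poly (in_alg L) (\prod_(z <- rs) ('X - z%:P))
    = \prod_(z <- map (in_alg L) rs) ('X - z%:P).
  rewrite rmorph_prod big_map; apply: eq_bigr => z _.
  by rewrite rmorphB /= map_polyX map_polyC.
have adjoin1 zs : {subset zs <= map (in_alg L) rs} -> <<1 & zs>>%VS = 1%VS.
  move=> sub; apply/eqP; rewrite eqEsubv subv_adjoin_seq andbT.
  apply/Fadjoin_seqP; split=> // z /sub/mapP[a _ ->].
  by apply/vlineP; exists a.
(* Any other list of linear factors has the same roots, hence again only elements from [F]. *)
split=> [[zs eq_zs <-] | ->].
  apply: adjoin1 => z; rewrite -root_prod_XsubC -(eqp_root eq_zs).
  by rewrite root_prod_XsubC.
by exists (map (in_alg L) rs); [exact: eqpxx | exact: adjoin1].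
Qed.

Lemma cdg_adj_sym (gT : finGroupType) (G : {group gT}) :
  symmetric (@cdg_adj gT G).
Proof.
by move=> p q; rewrite /cdg_adj eq_sym; under eq_has do rewrite mulnC.
Qed.

Lemma cdg_adj_irr (gT : finGroupType) (G : {group gT}) :
  irreflexive (@cdg_adj gT G).
Proof. by move=> p; rewrite /cdg_adj eqxx. Qed.

Theorem theorem3p1 (n : nat) (gT : finGroupType) (G : {group gT})
    (n_ge4 : (4 <= n)%N) (n_even : ~~ odd n) (solG : solvable G)
    (card_vertices : #|cdg_vertex G| = n)
    (regG : regular_graph (@cdg_adj gT G) (n - 2)) :
  let chi := graph_char_poly (@cdg_adj gT G) in
  [/\ chi = 'X ^+ n./2 * ('X + 2%:R%:P) ^+ (n./2 - 1) * ('X - (n - 2)%:R%:P),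
      forall (L : fieldExtType rat) (E : {vspace L}),
        splittingFieldFor 1 (map_poly (in_alg L) chi) E <-> E = 1%VS
    & forall (L : fieldExtType rat) (E : {vspace L}),
        splittingFieldFor 1 (map_poly (in_alg L) chi) E ->
        \dim_(1%VS : {vspace L}) E = 1%N].
Proof.
move=> chi.
have n_gt1 : (1 < n)%N by exact: leq_trans n_ge4.
have chiE : chi
    = 'X ^+ n./2 * ('X + 2%:R%:P) ^+ (n./2 - 1) * ('X - (n - 2)%:R%:P).
  (* The adjacency matrix has order [#|cdg_vertex G|], so [n] is first replaced by this cardinal. *)
  move: n_gt1 n_even regG; rewrite -{}card_vertices => n_gt1 n_even regG.
  have [s [sK s_neq adjE]] :=
    regular_co_matching (@cdg_adj_sym _ G) (@cdg_adj_irr _ G) n_gt1 regG.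
  (* The matching is carried from vertices to matrix indices along the enumeration. *)
  pose t (i : 'I_#|cdg_vertex G|) := enum_rank (s (enum_val i)).
  rewrite -(@char_poly_cocktail_party _ _ t) //.
  - congr char_poly; apply/matrixP=> i j; rewrite !mxE adjE.
    by rewrite (inj_eq enum_val_inj) -(inj_eq enum_val_inj j (t i)) enum_rankK.
  - by move=> i; rewrite /t enum_rankK sK enum_valK.
  by move=> i; rewrite -(inj_eq enum_val_inj) enum_rankK.
have split_chi (L : fieldExtType rat) (E : {vspace L}) :
    splittingFieldFor 1 (map_poly (in_alg L) chi) E <-> E = 1%VS.
  (* The eigenvalues 0, -2 and [n - 2], with multiplicity, are all rational. *)
  pose rs : seq rat :=
    nseq n./2 0 ++ nseq (n./2 - 1) (- 2%:R) ++ [:: (n - 2)%:R].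
  have -> : chi = \prod_(z <- rs) ('X - z%:P).
    rewrite chiE !big_cat big_seq1 /= !big_nseq !iter_mulr_1.
    by rewrite subr0 polyCN opprK mulrA.
  exact: splittingFieldFor_split.
split=> // L E /split_chi ->.
by rewrite divnn dimv1.
Qed.
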